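(* For integers $n\ge 0$ and $k$, let $c_{n,k}$ denote the number of tilings of the honeycomb strip $H_n$ using exactly $k$ dimers and $n-2k$ monomers (with $c_{n,k}=0$ for $k<0$). Then for every integer $n\ge 4$, $$c_{n,k}=c_{n-1,k}+c_{n-2,k-1}+c_{n-3,k-1}+c_{n-4,k-2},$$ with initial conditions $c_{0,0}=c_{1,0}=c_{2,0}=c_{3,0}=1$, $c_{2,1}=1$, $c_{3,1}=3$.
   Context: The honeycomb strip $H_n$ consists of $n$ regular hexagons arranged in two rows, numbered $1,\dots,n$ from the bottom left so that odd-numbered hexagons form the bottom row and even-numbered ones the top row; hexagon $i$ shares an edge with hexagons $i\pm1$ and $i\pm2$ (when they exist), and with no others. A monomer is a single hexagon; a dimer is a pair of edge-adjacent hexagons, i.e. either $\{i,i+1\}$ (a slanted dimer) or $\{i,i+2\}$ (a horizontal dimer). A tiling of $H_n$ is a partition of its $n$ hexagons into monomers and dimers. The empty strip $H_0$ has exactly one (empty) tiling. *)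

(* Defs.v *)
From mathcomp Require Import all_boot all_order all_algebra.

Set Implicit Arguments.
Unset Strict Implicit.
Unset Printing Implicit Defensive.

Import Order.TTheory GRing.Theory Num.Theory.

(* The ordinal i : 'I_n stands for hexagon number i + 1 of the strip H_n. *)
Definition hex_adj (n : nat) : rel 'I_n := fun i j =>
  [|| j == i + 1 :> nat, j == i + 2 :> nat,
      i == j + 1 :> nat | i == j + 2 :> nat].

Definition is_monomer (n : nat) (B : {set 'I_n}) : bool :=
  [exists i, B == [set i]].

Definition is_dimer (n : nat) (B : {set 'I_n}) : bool :=
  [exists i, exists j, hex_adj i j && (B == [set i; j])].

Definition is_tiling (n : nat) (P : {set {set 'I_n}}) : bool :=
  partition P [set: 'I_n] && [forall B in P, is_monomer B || is_dimer B].

Definition num_monomers (n : nat) (P : {set {set 'I_n}}) : nat :=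
  #|[set B in P | is_monomer B]|.

Definition num_dimers (n : nat) (P : {set {set 'I_n}}) : nat :=
  #|[set B in P | is_dimer B]|.

(* The counts are compared in int, so that k ranges over all integers and
   n - 2k is not truncated. *)
Definition c (n : nat) (k : int) : nat :=
  #|[set P : {set {set 'I_n}} |
      [&& is_tiling P,
          Posz (num_dimers P) == k
        & Posz (num_monomers P) == (Posz n - 2 * k)%R]]|.

Lemma c_neg (n : nat) (k : int) : (k < 0)%R -> c n k = 0.
Proof.
move=> k_lt0; apply/eqP; rewrite cards_eq0; apply/eqP/setP => P.
rewrite !inE; apply/negbTE/negP => /and3P[_ /eqP kE _].
by rewrite -kE in k_lt0.
Qed.

(* Main.v *)
(** Fix a region A of the strip and a hexagon x of A. Classifying the tilings of
    A by the block B containing x, and deleting B, gives a bijection with the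
    tilings of A minus B. Applied to the last hexagon of an initial segment, this
    leaves shorter initial segments, except when the last hexagon is paired with
    the one two places before; the region left then has a gap, and a second
    application to its last hexagon finishes the recurrence. All regions live in
    the same strip, and counting the monomers along with the dimers makes the
    condition on their number follow the recurrence. *)

Require Import Defs.
From mathcomp Require Import all_boot all_order all_algebra.
From mathcomp Require Import zify.

Set Implicit Arguments.
Unset Strict Implicit.
Unset Printing Implicit Defensive.

Import Order.TTheory GRing.Theory Num.Theory.

(** The counts [k] and [j] are independent integers: deleting a block lowers just one of them, and a
    negative value simply gives no tiling. *)
Definition tilings (n : nat) (A : {set 'I_n}) (k j : int) :
    {set {set {set 'I_n}}} :=
  [set P | [&& partition P A && [forall B in P, is_monomer B || is_dimer B],
      Posz (num_dimers P) == k & Posz (num_monomers P) == j]].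

(** * Deleting one block from the tilings of a region *)

Section Blocks.
Variable n : nat.
Implicit Types (A B : {set 'I_n}) (P : {set {set 'I_n}}) (x y i : 'I_n).

Lemma hex_adj_neq x y : hex_adj x y -> x != y.
Proof. by rewrite /hex_adj -val_eqE /=; lia. Qed.

Lemma hex_adjC x y : hex_adj x y = hex_adj y x.
Proof. by rewrite /hex_adj; lia. Qed.

Lemma is_monomer1 x : is_monomer [set x].
Proof. by apply/existsP; exists x. Qed.

Lemma card_monomer B : is_monomer B -> #|B| = 1.
Proof. by case/existsP=> x /eqP->; rewrite cards1. Qed.

Lemma card_dimer B : is_dimer B -> #|B| = 2.
Proof.
by case/existsP=> x /existsP[y] /andP[/hex_adj_neq xy /eqP->]; rewrite cards2 xy.
Qed.

Lemma is_dimer2 x y : hex_adj x y -> is_dimer [set x; y].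
Proof.
by move=> xy; apply/existsP; exists x; apply/existsP; exists y; rewrite xy eqxx.
Qed.

Lemma card_filterU1 (p : pred {set 'I_n}) B P :
  B \notin P -> #|[set C in B |: P | p C]| = p B + #|[set C in P | p C]|.
Proof.
move=> BP; case pB: (p B).
  have -> : [set C in B |: P | p C] = B |: [set C in P | p C].
    by apply/setP=> C; rewrite !inE; case: eqP => // ->; rewrite pB.
  by rewrite cardsU1 !inE (negbTE BP).
congr #|pred_of_set _|; apply/setP=> C; rewrite !inE.
by case: eqP => // ->; rewrite pB (negbTE BP).
Qed.

(** Inserting [B] is inverse to deleting it. The 0/1 values of [is_dimer B] and [is_monomer B] treat
    both kinds of block at once. *)
Lemma card_tilings_block A B (k j : int) :
    B \subset A -> is_monomer B || is_dimer B ->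
  #|[set P in tilings A k j | B \in P]| =
    #|tilings (A :\: B) (k - Posz (is_dimer B)) (j - Posz (is_monomer B))|.
Proof.
move=> sBA tB.
(* A nonempty [B] is never a block of a partition of [A :\: B], so inserting it is injective and
   really adds a block. *)
have B0 : B != set0.
  by rewrite -card_gt0; case/orP: tB => [/card_monomer|/card_dimer] ->.
have BN P : partition P (A :\: B) -> B \notin P.
  move=> pP; apply/negP=> BP; case/set0Pn: B0 => x Bx.
  by have /subsetP/(_ x Bx) := partitionS pP BP; rewrite inE Bx.
rewrite -[RHS](@card_in_imset _ _ (fun P => B |: P)); last first.
  move=> P Q; rewrite !inE => /andP[/andP[/BN BP _] _] /andP[/andP[/BN BQ _] _] eqPQ.
  by rewrite -(setU1K BP) eqPQ setU1K.
congr #|pred_of_set _|; apply/setP=> P; rewrite !inE; apply/idP/imsetP.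
  case/andP=> /and3P[/andP[pP /forall_inP tP] dP mP] BP.
  have BP' : B \notin P :\ B by rewrite !inE eqxx.
  exists (P :\ B); last by rewrite setD1K.
  rewrite inE partitionD1 //=.
  move: dP mP; rewrite -{1 2}(setD1K BP) /num_dimers /num_monomers !card_filterU1 //.
  move=> dP mP; apply/and3P; split.
  - by apply/forall_inP=> C /setD1P[_]; apply: tP.
  - by rewrite -(eqP dP) PoszD addrAC subrr add0r.
  - by rewrite -(eqP mP) PoszD addrAC subrr add0r.
case=> Q; rewrite inE => /and3P[/andP[pQ /forall_inP tQ] dQ mQ] ->.
rewrite setU11 andbT /num_dimers /num_monomers !card_filterU1 ?BN //.
have -> : partition (B |: Q) A.
  rewrite -[X in partition _ X](setID A B) (setIidPr sBA) partitionU1 //.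
  by rewrite disjoints_subset setCD subsetUr.
move: dQ mQ; rewrite /num_dimers /num_monomers => dQ mQ.
apply/and3P; split.
- by apply/forall_inP=> C /setU1P[->|] //; apply: tQ.
- by rewrite PoszD (eqP dQ) addrC subrK.
- by rewrite PoszD (eqP mQ) addrC subrK.
Qed.

Lemma block_containing x B : x \in B -> is_monomer B || is_dimer B ->
  B \in [set x] |: [set [set x; y] | y in [pred y | hex_adj x y]].
Proof.
move=> xB /orP[/existsP[y /eqP eB]|/existsP[y /existsP[z /andP[yz /eqP eB]]]].
  by move: xB; rewrite eB !inE => /eqP->; rewrite eqxx.
rewrite in_setU1; apply/orP; right.
move: xB; rewrite eB => /set2P[] ->; apply/imsetP; first by exists z; rewrite ?inE.
by exists y; rewrite 1?setUC // inE hex_adjC.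
Qed.

Lemma card_tilings_rec A x (k j : int) : x \in A ->
  #|tilings A k j| = #|tilings (A :\ x) k (j - 1)%R| +
    \sum_(y in A | hex_adj x y) #|tilings (A :\: [set x; y]) (k - 1)%R j|.
Proof.
move=> xA.
(* The blocks that may cover [x] inside [A]; the tilings are sorted by [pblock P x], which lies in
   [D]. *)
pose D : {set {set 'I_n}} :=
  [set x] |: [set [set x; y] | y in [pred y in A | hex_adj x y]].
have tD B : B \in D -> [/\ B \subset A, x \in B & is_monomer B || is_dimer B].
  case/setU1P=> [->|/imsetP[y]]; first by rewrite sub1set set11 is_monomer1.
  rewrite !inE => /andP[yA xy] ->.
  by rewrite subUset !sub1set xA yA set21 is_dimer2 // orbT.
rewrite -sum1_card (partition_big (fun P => pblock P x) (mem D)) /=; last first.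
  move=> P; rewrite inE => /and3P[/andP[pP /forall_inP tP] _ _].
  have xP : x \in cover P by rewrite (cover_partition pP).
  have BP := pblock_mem xP.
  have xB : x \in pblock P x by rewrite mem_pblock.
  have := block_containing xB (tP _ BP).
  case/setU1P=> [->|/imsetP[y xy e]]; first exact: setU11.
  rewrite e in_setU1; apply/orP; right; apply/imsetP; exists y => //.
  move: xy; rewrite !inE => ->; rewrite andbT; have /subsetP := partitionS pP BP.
  by apply; rewrite e set22.
have step B : B \in D -> \sum_(P in tilings A k j | pblock P x == B) 1 =
    #|tilings (A :\: B) (k - Posz (is_dimer B)) (j - Posz (is_monomer B))|.
  move=> /tD[sBA xB tB]; rewrite -card_tilings_block // sum1dep_card.
  congr #|pred_of_set _|; apply/setP=> P; rewrite !inE.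
  apply: andb_id2l => /and3P[/andP[pP _] _ _].
  apply/eqP/idP => [<-|BP]; first by rewrite pblock_mem // (cover_partition pP).
  exact: def_pblock (partition_trivIset pP) BP xB.
(* The monomer at [x] differs in size from every pair, so it splits off from the sum over [D]. *)
rewrite (eq_bigr _ step) big_setU1 /=; last first.
  apply/imsetP=> -[y]; rewrite !inE => /andP[_ /hex_adj_neq xy] /(congr1 (fun B => #|B|)).
  by rewrite cards1 cards2 xy.
have mN B : is_monomer B -> is_dimer B = false.
  by move=> /card_monomer mB; apply/negbTE/negP=> /card_dimer; rewrite mB.
rewrite is_monomer1 mN ?is_monomer1 // subr0; congr (_ + _).
(* A pair containing [x] determines its other hexagon, so the sum over dimers becomes a sum over
   neighbours. *)
rewrite big_imset /=; last first.
  move=> y z; rewrite !inE => /andP[_ /hex_adj_neq xy] /andP[_ /hex_adj_neq xz] e.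
  have : y \in [set x; z] by rewrite -e set22.
  by rewrite !inE eq_sym (negbTE xy) => /eqP.
apply: eq_bigr => y; rewrite !inE => /andP[_ xy].
have dB := is_dimer2 xy; rewrite dB; case mB: (is_monomer _); last by rewrite subr0.
by rewrite (mN _ mB) in dB.
Qed.

Lemma card_tilings0 (k j : int) :
  #|tilings (set0 : {set 'I_n}) k j| = (k == 0%R) && (j == 0%R).
Proof.
rewrite -sum1_card big_mkcond (bigD1 set0) //= big1 ?addn0 => [|P P0]; last first.
  by rewrite inE partition_set0 (negbTE P0).
rewrite inE partition_set0 eqxx /= /num_dimers /num_monomers.
have E (p : pred {set 'I_n}) : #|[set B in set0 | p B]| = 0.
  by apply/eqP; rewrite cards_eq0; apply/eqP/setP=> B; rewrite !inE.
rewrite !E (eq_sym k) (eq_sym j).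
by case: forall_inP => // -[] B; rewrite inE.
Qed.

End Blocks.

(** * Removing the last hexagon of a region *)

(** As [x] is the largest element, only its neighbours below can lie in the region. The guards are
    needed because [.-1] and [.-2] truncate: [0.-1] is [x] itself for [x = 0], and [1.-2] is the
    other neighbour for [x = 1]. Giving the region by a predicate on [nat] reduces equality of
    regions to arithmetic. *)
Lemma card_tilings_max n (a : pred nat) x (k j : int) :
    x < n -> a x -> (forall y, a y -> y <= x) ->
  #|tilings [set i : 'I_n | a i] k j| =
    #|tilings [set i : 'I_n | a i && (i != x :> nat)] k (j - 1)%R|
    + (if (0 < x) && a x.-1
       then #|tilings [set i : 'I_n | a i && (nat_of_ord i \notin [:: x; x.-1])] (k - 1)%R j|
       else 0)
    + (if (1 < x) && a x.-2
       then #|tilings [set i : 'I_n | a i && (nat_of_ord i \notin [:: x; x.-2])] (k - 1)%R j|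
       else 0).
Proof.
move=> xn ax amax.
pose H y := #|tilings [set i : 'I_n | a i && (nat_of_ord i \notin [:: x; y])] (k - 1)%R j|.
rewrite (@card_tilings_rec _ _ (Ordinal xn)) ?inE // -addnA; congr (_ + _).
  by congr #|pred_of_set (tilings _ _ _)|; apply/setP=> i; rewrite !inE -val_eqE andbC.
transitivity (\sum_(y < n | a y && ((x == y + 1) || (x == y + 2))) H y).
  apply: eq_big => [y|y _]; last first.
    congr #|pred_of_set (tilings _ _ _)|; apply/setP=> i.
    by rewrite !inE -!val_eqE /= andbC.
  rewrite inE /hex_adj /=; case ay: (a y) => //=.
  by have := amax _ ay; lia.
(* Each half of the split sum has at most one index, [x.-1] or [x.-2]. *)
rewrite (bigID (fun y : 'I_n => y.+1 == x)) /= -/(H x.-1) -/(H x.-2); congr (_ + _).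
  rewrite (eq_bigl (fun y : 'I_n => ((0 < x) && a y) && (y == x.-1 :> nat))).
    by rewrite (big_ord1_cond_eq _ H (fun y => (0 < x) && a y)) (leq_ltn_trans (leq_pred x) xn).
  by move=> y /=; lia.
rewrite (eq_bigl (fun y : 'I_n => ((1 < x) && a y) && (y == x.-2 :> nat))).
  by rewrite (big_ord1_cond_eq _ H (fun y => (1 < x) && a y)) (_ : x.-2 < n) //; lia.
by move=> y /=; lia.
Qed.

(** * Strips as initial segments of a longer strip *)

Section Widen.
Variables (m n : nat) (le_mn : m <= n).
Let f := widen_ord le_mn.
Implicit Types (B : {set 'I_m}) (P : {set {set 'I_m}}).

Let f_inj : injective f.
Proof. by move=> x y /(congr1 val) /= /val_inj. Qed.

Let F P := [set f @: (B : {set 'I_m}) | B in P].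

Let F_inj : injective F.
Proof. exact: imset_inj (imset_inj f_inj). Qed.

Lemma is_monomer_widen B : is_monomer (f @: B) = is_monomer B.
Proof.
apply/idP/idP => [/card_monomer|/existsP[x /eqP->]]; last first.
  by rewrite imset_set1 is_monomer1.
rewrite card_imset // => /eqP/cards1P[x ->]; exact: is_monomer1.
Qed.

Lemma is_dimer_widen B : is_dimer (f @: B) = is_dimer B.
Proof.
apply/existsP/existsP => -[x /existsP[y /andP[xy /eqP e]]]; last first.
  exists (f x); apply/existsP; exists (f y).
  by rewrite [hex_adj _ _]xy e imsetU !imset_set1 /=.
have /imsetP[u _ ux] : x \in f @: B by rewrite e set21.
have /imsetP[v _ vy] : y \in f @: B by rewrite e set22.
exists u; apply/existsP; exists v; move: xy e; rewrite ux vy => uv e.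
apply/andP; split; first exact: uv.
by apply/eqP/(imset_inj f_inj); rewrite e imsetU !imset_set1.
Qed.

Let card_filter_widen (p : pred {set 'I_m}) (q : pred {set 'I_n}) P :
  (forall B, q (f @: B) = p B) ->
  #|[set C in F P | q C]| = #|[set B in P | p B]|.
Proof.
move=> qp; rewrite -(card_imset _ (imset_inj f_inj)).
congr #|pred_of_set _|; apply/setP=> C; rewrite !inE; apply/andP/imsetP.
  by case=> /imsetP[B BP ->]; rewrite qp => pB; exists B; rewrite ?inE ?BP.
by case=> B; rewrite inE => /andP[BP pB] ->; rewrite qp imset_f.
Qed.

(** Strips of different lengths have different types; this puts them into one strip, where their
    tilings can be compared. Widening preserves adjacency, hence the kind of each block. *)
Lemma card_tilings_widen (k j : int) :
  #|tilings [set: 'I_m] k j| = #|tilings [set i : 'I_n | i < m] k j|.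
Proof.
have fT : [set i : 'I_n | i < m] = f @: [set: 'I_m].
  apply/setP=> i; rewrite inE; apply/idP/imsetP => [im|[x _ ->]]; last by case: x.
  by exists (Ordinal im); rewrite ?inE //; apply: val_inj.
have inF P : (F P \in tilings [set i : 'I_n | i < m] k j) = (P \in tilings [set: 'I_m] k j).
  rewrite !inE fT imset_partition // /num_dimers /num_monomers.
  rewrite (card_filter_widen _ is_dimer_widen) (card_filter_widen _ is_monomer_widen).
  congr ((_ && _) && _); apply/forall_inP/forall_inP => tP.
    by move=> B BP; rewrite -is_monomer_widen -is_dimer_widen tP ?imset_f.
  by move=> _ /imsetP[B BP ->]; rewrite is_monomer_widen is_dimer_widen tP.
rewrite -(card_imset _ F_inj); congr #|pred_of_set _|; apply/setP=> Q.
apply/imsetP/idP => [[P PT ->]|QT]; first by rewrite inF.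
pose P := [set f @^-1: (C : {set 'I_n}) | C in Q].
suff eQ : Q = F P by exists P; rewrite -?inF -?eQ.
(* Blocks of [Q] lie in the range of [f], so taking preimages loses nothing. *)
have fK (C : {set 'I_n}) : C \in Q -> f @: (f @^-1: C) = C.
  move=> CQ; move: QT; rewrite inE => /and3P[/andP[pQ _] _ _].
  apply/setP=> i; apply/imsetP/idP => [[x]|iC]; first by rewrite inE => ? ->.
  have /subsetP/(_ i iC) := partitionS pQ CQ; rewrite fT => /imsetP[x _ ix].
  by exists x; rewrite // inE -ix.
rewrite /F /P -imset_comp; apply/setP=> C; apply/idP/imsetP => [CQ|[D DQ ->]].
  by exists C; rewrite //= fK.
by rewrite /= fK.
Qed.

End Widen.

(** * Recurrence and initial values for [c] *)

Lemma c_tilings m n (k : int) : m <= n ->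
  c m k = #|tilings [set i : 'I_n | i < m] k (Posz m - 2 * k)%R|.
Proof. by move=> le_mn; rewrite -(card_tilings_widen le_mn). Qed.

Lemma eq_tilings n (A B : {set 'I_n}) (k j k' j' : int) :
  A =i B -> k = k' -> j = j' -> #|tilings A k j| = #|tilings B k' j'|.
Proof. by move=> /setP-> -> ->. Qed.

Lemma c_0 (k : int) : c 0 k = (k == 0%R).
Proof.
rewrite (@c_tilings 0 0) // (_ : [set i : 'I_0 | i < 0] = set0).
  by rewrite card_tilings0; case: eqP => // ->.
by apply/setP=> -[].
Qed.

Lemma c_1 (k : int) : c 1 k = c 0 k.
Proof.
rewrite !(@c_tilings _ 1) // (@card_tilings_max _ (fun i => i < 1) 0) //=.
rewrite !addn0; apply: eq_tilings => [i|//|]; rewrite ?inE; lia.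
Qed.

Lemma c_2 (k : int) : c 2 k = c 1 k + c 0 (k - 1)%R.
Proof.
rewrite !(@c_tilings _ 2) // (@card_tilings_max _ (fun i => i < 2) 1) //=.
rewrite !addn0; congr (_ + _); apply: eq_tilings => [i|//|]; rewrite ?inE; lia.
Qed.

(* If the last hexagon m + 3 is paired with m + 1, then m + 2 is the last free
   hexagon and can only be a monomer or be paired with m. *)
Lemma c_rec m (k : int) :
  c m.+3 k = c m.+2 k + c m.+1 (k - 1)%R + c m (k - 1)%R
             + (if 0 < m then c m.-1 (k - 2)%R else 0).
Proof.
rewrite !(@c_tilings _ m.+3) //; try lia.
rewrite (@card_tilings_max _ (fun i => i < m.+3) m.+2) //=.
rewrite -!addnA; congr (_ + _); first by apply: eq_tilings => [i|//|]; rewrite ?inE; lia.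
rewrite ifT; last lia.
congr (_ + _); first by apply: eq_tilings => [i|//|]; rewrite ?inE; lia.
rewrite ifT; last lia.
rewrite (@card_tilings_max _ (fun i => (i < m.+3) && (i \notin [:: m.+2; m])) m.+1) //=; last 2 first.
- by rewrite !inE; lia.
- by move=> y; rewrite !inE; lia.
(* The ordinal [m] is already taken, so [m.+1] cannot be paired with it. *)
rewrite [X in _ + X + _]ifF ?addn0; last by rewrite !inE; lia.
congr (_ + _); first by apply: eq_tilings => [i|//|]; rewrite ?inE; lia.
(* For [m = 0] there is no hexagon left to pair with and the fourth term is absent. *)
rewrite !inE; case: m => [|m] //=; rewrite ifT; last lia.
by apply: eq_tilings => [i||]; rewrite ?inE; lia.
Qed.

Theorem theorem1 :
  (forall (n : nat) (k : int), 4 <= n ->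
     c n k = c (n - 1) k + c (n - 2) (k - 1)%R
             + c (n - 3) (k - 1)%R + c (n - 4) (k - 2)%R)
  /\ [/\ c 0 0%R = 1, c 1 0%R = 1, c 2 0%R = 1 & c 3 0%R = 1]
  /\ c 2 1%R = 1 /\ c 3 1%R = 3.
Proof.
split=> [[|[|[|[|n]]]] // k _|]; first by rewrite c_rec !subSS !subn0.
(* The case [m = 0] of [c_rec] brings [c 3] down to [c 2], [c 1] and [c 0], hence to tests of
   integers against 0. *)
by rewrite !c_rec /= !c_2 !c_1 !c_0.
Qed.
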